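(* Let $0<\alpha<\beta$ be real numbers. Let $(\alpha_j)_{j\ge1}$ and $(\beta_j)_{j\ge1}$ be increasing sequences of real numbers with $0<\alpha_j<\beta_j$ and $\frac{\alpha_j}{\beta_j}=\frac{\alpha}{\beta}$ for all $j=1,2,3,\ldots$, and $\alpha_j\to\infty$ as $j\to\infty$. Let $f:[0,1]\to\mathbb{R}$ be a function that is continuous at $\frac{\alpha}{\beta}$, and let $n$ be any fixed natural number. Then $B_n^{\alpha_l,\beta_l}(f;\cdot)$ can be brought arbitrarily close to $f\left(\frac{\alpha}{\beta}\right)$ for some member $(\alpha_l,\beta_l)$ of the sequences; that is, for every $\epsilon>0$ there exists an index $l$ such that for all $x\in[0,1]$ $$\left|B_n^{\alpha_l,\beta_l}(f;x)-f\left(\frac{\alpha}{\beta}\right)\right|<\epsilon .$$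
   Context: Natural numbers are $1,2,3,\ldots$. For real numbers $0\le a\le b$, a natural number $n$, a function $f:[0,1]\to\mathbb{R}$ and $x\in[0,1]$, the Bernstein-Stancu operator is $$B_n^{a,b}(f;x)=\sum_{k=0}^n b_{n,k}(x)\,f\left(\frac{k+a}{n+b}\right),\qquad b_{n,k}(x)=\binom{n}{k}x^k(1-x)^{n-k}.$$ *)

(* Defs.v *)
From HB Require Import structures.
From mathcomp Require Import all_boot all_order all_algebra.
From mathcomp Require Import all_classical all_reals all_analysis.

Set Implicit Arguments.
Unset Strict Implicit.
Unset Printing Implicit Defensive.

Import Order.TTheory GRing.Theory Num.Theory.
Import numFieldNormedType.Exports.

Local Open Scope classical_set_scope.
Local Open Scope ring_scope.

Definition bernstein_basis (R : realType) (n k : nat) (x : R) : R :=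
  'C(n, k)%:R * x ^+ k * (1 - x) ^+ (n - k).

(* A function on [0, 1] is represented by a total function f : R -> R.  When
   0 <= a <= b and 0 < n, only values of f on [0, 1] are used
   (lemma stancu_node_itv). *)
Definition bernstein_stancu (R : realType) (a b : R) (n : nat) (f : R -> R)
    (x : R) : R :=
  \sum_(k < n.+1) bernstein_basis n k x * f ((k%:R + a) / (n%:R + b)).

Lemma stancu_node_itv (R : realType) (a b : R) (n k : nat) :
  0 <= a -> a <= b -> (0 < n)%N -> (k <= n)%N ->
  (k%:R + a) / (n%:R + b) \in `[0, 1].
Proof.
move=> a0 ab n0 kn; have d0 : 0 < n%:R + b.
  by rewrite ltr_wpDr ?ltr0n// (le_trans a0 ab).
rewrite in_itv/=; apply/andP; split.
  by rewrite divr_ge0 ?(ltW d0)// addr_ge0.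
by rewrite ler_pdivrMr// mul1r lerD// ler_nat.
Qed.

(* Main.v *)
(** Since [a_l / b_l = alpha / beta] and [a_l] tends to infinity with [n] fixed,
    all nodes [(k + a_l) / (n + b_l)] lie within [n / a_l] of [alpha / beta];
    [B_n f x] is a convex combination of the values of [f] at these nodes, all
    of which are close to [f (alpha / beta)]. *)
Require Import Defs.
From HB Require Import structures.
From mathcomp Require Import all_boot all_order all_algebra.
From mathcomp Require Import all_classical all_reals all_analysis.
From mathcomp Require Import ring lra.

Set Implicit Arguments.
Unset Strict Implicit.
Unset Printing Implicit Defensive.

Import Order.TTheory GRing.Theory Num.Theory.
Import numFieldNormedType.Exports.

Local Open Scope classical_set_scope.
Local Open Scope ring_scope.

(** Binomial expansion of [((1 - x) + x) ^+ n]. *)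
Lemma sum_bernstein_basis (R : realType) (n : nat) (x : R) :
  \sum_(k < n.+1) bernstein_basis n k x = 1.
Proof.
rewrite -[RHS](expr1n R n) -[in RHS](subrK x 1) exprDn.
by apply: eq_bigr => k _; rewrite /bernstein_basis -mulrA mulr_natl mulrC.
Qed.

Lemma bernstein_basis_ge0 (R : realType) (n k : nat) (x : R) :
  0 <= x <= 1 -> 0 <= bernstein_basis n k x.
Proof.
by move=> /andP[x0 x1]; rewrite !mulr_ge0 ?exprn_ge0 ?subr_ge0 ?ler0n.
Qed.

Lemma bernstein_stancu_dist (R : realType) (a b c e : R) (n : nat)
    (f : R -> R) (x : R) :
  0 <= x <= 1 ->
  (forall k : nat, (k <= n)%N ->
     `|f ((k%:R + a) / (n%:R + b)) - c| <= e) ->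
  `|bernstein_stancu a b n f x - c| <= e.
Proof.
move=> x01 fce; rewrite /bernstein_stancu.
(* The weights sum to 1, so [c] and [e] can both be spread over them; the claim then reduces to a
   comparison term by term. *)
have sumE y : y = \sum_(k < n.+1) bernstein_basis n k x * y.
  by rewrite -mulr_suml sum_bernstein_basis mul1r.
rewrite [c in _ - c]sumE [leRHS]sumE -sumrB.
apply: le_trans (ler_norm_sum _ _ _) _; apply: ler_sum => k _.
rewrite -mulrBr normrM ger0_norm ?bernstein_basis_ge0//.
by rewrite ler_wpM2l ?bernstein_basis_ge0// fce// -ltnS.
Qed.

(** Over a common denominator the difference is [(k - n * (a / b)) / (n + b)]. Both [k] and
    [n * (a / b)] lie between 0 and [n], and [n + b >= a]. The bound uses [a] rather than [b]
    because it is [alpha_] that is assumed to diverge. *)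
Lemma stancu_node_dist (R : realType) (a b : R) (n k : nat) :
  0 < a -> a <= b -> (k <= n)%N ->
  `|(k%:R + a) / (n%:R + b) - a / b| <= n%:R / a.
Proof.
move=> a0 ab kn; have b0 : 0 < b by exact: lt_le_trans ab.
have n0 : 0 <= n%:R :> R by [].
have nb0 : 0 < n%:R + b by rewrite ltr_wpDl.
have -> : (k%:R + a) / (n%:R + b) - a / b
          = (k%:R - n%:R * (a / b)) / (n%:R + b).
  by field; rewrite !gt_eqF.
rewrite normrM normfV (gtr0_norm nb0).
apply: ler_pM => //; first by rewrite invr_ge0 ltW.
  have r0 : 0 <= a / b by rewrite divr_ge0 ?ltW.
  have r1 : a / b <= 1 by rewrite ler_pdivrMr// mul1r.
  have k0 : 0 <= k%:R :> R by [].
  have {}kn : k%:R <= n%:R :> R by rewrite ler_nat.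
  by rewrite ler_norml; apply/andP; split; nra.
by rewrite lef_pV2 ?posrE//; lra.
Qed.

Theorem theorem4 (R : realType) (alpha beta : R) (alpha_ beta_ : nat -> R)
    (f : R -> R) (n : nat)
    (alpha_gt0 : 0 < alpha) (alpha_lt_beta : alpha < beta)
    (alpha_incr : forall i j : nat,
       (1 <= i)%N -> (i <= j)%N -> alpha_ i <= alpha_ j)
    (beta_incr : forall i j : nat,
       (1 <= i)%N -> (i <= j)%N -> beta_ i <= beta_ j)
    (alpha_beta_j : forall j : nat, (1 <= j)%N -> 0 < alpha_ j < beta_ j)
    (ratio_j : forall j : nat, (1 <= j)%N -> alpha_ j / beta_ j = alpha / beta)
    (alpha_cvg : alpha_ j @[j --> \oo] --> +oo)
    (f_cont : f x @[x --> within `[0, 1] (nbhs (alpha / beta))]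
                --> f (alpha / beta))
    (n_ge1 : (1 <= n)%N) :
  forall eps : R, 0 < eps ->
    exists l : nat, (1 <= l)%N /\
      forall x : R, 0 <= x <= 1 ->
        `| bernstein_stancu (alpha_ l) (beta_ l) n f x - f (alpha / beta) |
          < eps.
Proof.
move=> eps eps0; have eps20 : 0 < eps / 2 by rewrite divr_gt0.
have /cvgrPdist_lt/(_ _ eps20) := f_cont.
rewrite near_withinE => /nbhs_ballP[d /= d0 fd].
(* This choice makes [n / alpha_ l < d], so every node falls within the radius of continuity. The
   witness [N.+1] keeps the index positive even if [N] is 0. *)
have [l [l1 al]] : exists l, (1 <= l)%N /\ n%:R / d < alpha_ l.
  have /cvgryPgt/(_ (n%:R / d)) [N _ HN] := alpha_cvg.
  by exists N.+1; split=> //; apply: HN => /=.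
exists l; split=> // x x01; have /andP[a0 ab] := alpha_beta_j l l1.
(* The averaging bound is not strict; halving [eps] restores strictness. *)
apply: (@le_lt_trans _ _ (eps / 2)); last by lra.
apply: bernstein_stancu_dist => // k kn; rewrite distrC; apply/ltW/fd; last first.
  (* Continuity is only relative to [[0, 1]], so the nodes must lie there. *)
  by apply: stancu_node_itv => //; exact: ltW.
(* The common ratio makes [alpha / beta] the limit point for the parameters of index [l]. *)
rewrite /ball/= distrC -(ratio_j l l1).
apply: le_lt_trans (stancu_node_dist a0 (ltW ab) kn) _.
by rewrite ltr_pdivrMr// mulrC -ltr_pdivrMr.
Qed.
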